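(* Let $Y$ be a real vector space, $A$ a nonempty proper subset of $Y$ and $k\in Y\setminus\{0\}$ with $k\in-\operatorname{core}0^+A$. Then $\varphi_{A,k}$ is finite-valued, i.e. $\varphi_{A,k}(y)\in\mathbb{R}$ for all $y\in Y$, and $$\{y\in Y\mid\varphi_{A,k}(y)<t\}=\operatorname{core}A+tk\quad\text{for all } t\in\mathbb{R}.$$
   Context: For nonempty $A\subseteq Y$ and $k\in Y\setminus\{0\}$, $\varphi_{A,k}(y):=\inf\{t\in\mathbb{R}\mid y\in A+tk\}$ for $y\in Y$, where $\inf\emptyset:=\nu$ with $\nu$ a symbol not in $\mathbb{R}\cup\{-\infty,+\infty\}$ (not comparable with real numbers), and the infimum is $-\infty$ if the set is unbounded below. The recession cone of $A$ is $0^+A:=\{u\in Y\mid\forall a\in A\ \forall t\in[0,\infty):\ a+tu\in A\}$. $\operatorname{core}B$ denotes the algebraic interior of $B\subseteq Y$: $b\in\operatorname{core}B$ iff $b\in B$ and for each $v\in Y$ there is $\varepsilon>0$ with $b+sv\in B$ for all $s\in[0,\varepsilon]$. *)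

(* Defs.v *)
From mathcomp Require Import all_boot all_order all_algebra.
From mathcomp Require Import all_classical all_reals.
From mathcomp Require Export ereal.

Set Implicit Arguments.
Unset Strict Implicit.
Unset Printing Implicit Defensive.
Import Order.TTheory GRing.Theory Num.Theory.
Local Open Scope classical_set_scope.
Local Open Scope ring_scope.

Definition translate (V : zmodType) (A : set V) (v : V) : set V :=
  [set a + v | a in A].

Definition opp_set (V : zmodType) (A : set V) : set V := [set - a | a in A].

Definition recession_cone (R : realType) (Y : lmodType R) (A : set Y) : set Y :=
  [set u | forall a, A a -> forall t : R, 0 <= t -> A (a + t *: u)].

Definition core (R : realType) (Y : lmodType R) (B : set Y) : set Y :=
  [set b | B b /\ forall v : Y, exists2 e : R, 0 < e &
     forall s : R, 0 <= s <= e -> B (b + s *: v)].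

(* The codomain is R, -oo and +oo together with the extra symbol nu := None,
   which is the infimum of the empty set; [ereal_inf] alone would send the
   empty set to +oo. *)
Definition phi (R : realType) (Y : lmodType R) (A : set Y) (k : Y) (y : Y) :
    option (\bar R) :=
  let S := [set t : R | translate A (t *: k) y] in
  if `[< S = set0 >] then None else Some (ereal_inf (EFin @` S)).

(* nu is not comparable with real numbers, hence is not below any of them. *)
Definition lt_nu (R : realType) (x : option (\bar R)) (t : R) : Prop :=
  if x is Some e then (e < t%:E)%E else False.

(* Main.v *)
Require Import Defs.
From mathcomp Require Import all_boot all_order all_algebra.
From mathcomp Require Import all_classical all_reals.
Import Order.TTheory GRing.Theory Num.Theory.
Local Open Scope classical_set_scope.
Local Open Scope ring_scope.

(** Put [u = - k], an algebraically interior point of the recession cone [C] of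
    [A].  Then [y] lies in [A + t k] iff the point at time [t] of the ray
    [y + t u] lies in [A], so [phi A k y] is the entry time of that ray into
    [A], after which the ray never leaves [A].

    Interiority of [u] means that [C] absorbs every vector: for each [v], some
    [v + t u] is in [C] ([core_cone_absorb]).  Applied to [v = y - a] with [a] in
    [A], this makes every ray enter [A]; applied to [v = b - y] with [b]
    outside [A], it shows that a ray that has been in [A] since arbitrarily
    early times would force [b] into [A].  Hence the entry time is a real
    number ([entry_times_neq0], [entry_times_lbound]).

    For the sublevel sets: a positive multiple of [u] moves every point of [A]
    into the core of [A] ([core_shift]), so after its entry time the ray runs in
    the core; conversely, from a core point one can step back a little in the
    direction [- u] and remain in [A], so the entry time was earlier. *)

Lemma translateE (V : zmodType) (A : set V) (v y : V) :
  translate A v y = A (y - v).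
Proof.
apply/propext; split=> [[a Aa <-]|Ayv]; first by rewrite addrK.
by exists (y - v) => //; rewrite subrK.
Qed.

(** An infimum is below [t] iff some element of the set is; this covers the
    empty set of times too, since its infimum nu is below no real number. *)
Lemma lt_nu_phi (R : realType) (Y : lmodType R) (A : set Y) (k y : Y) (t : R) :
  lt_nu (phi A k y) t <-> exists2 s : R, s < t & A (y - s *: k).
Proof.
rewrite /phi; case: asboolP => [S0|_] /=.
  split=> // -[s _ As].
  suff : [set s : R | translate A (s *: k) y] s by rewrite S0.
  by rewrite /= translateE.
split=> [/ereal_inf_lt [_ [s Ss <-]]|[s st As]].
  by rewrite lte_fin => st; exists s; rewrite // -translateE.
apply: (@le_lt_trans _ _ s%:E); last by rewrite lte_fin.
by apply: ereal_inf_lbound; exists s; rewrite //= translateE.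
Qed.

Section RecessionCone.
Context {R : realType} {Y : lmodType R} {A : set Y}.
Implicit Types (u v y : Y) (s t : R).

Lemma recession_coneZ t u :
  0 <= t -> recession_cone A u -> recession_cone A (t *: u).
Proof.
move=> t0 Cu a Aa s s0; rewrite scalerA; apply: Cu => //; exact: mulr_ge0.
Qed.

Lemma recession_coneD1 {u a} : recession_cone A u -> A a -> A (a + u).
Proof. by move=> Cu Aa; rewrite -[u]scale1r; apply: Cu. Qed.

(** If [e > 0] is so small that [u + e v] is in the cone, then so is its
    multiple [e^-1 (u + e v) = v + e^-1 u]. *)
Lemma core_cone_absorb {u} v : core (recession_cone A) u ->
  exists t : R, recession_cone A (v + t *: u).
Proof.
move=> [_ /(_ v) [e e0 Ce]]; exists e^-1.
have -> : v + e^-1 *: u = e^-1 *: (u + e *: v).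
  by rewrite scalerDr scalerA mulVf ?gt_eqF// scale1r addrC.
apply: recession_coneZ; first by rewrite invr_ge0 ltW.
by apply: Ce; rewrite lexx ltW.
Qed.

(** A translate of the recession cone at [a] lies inside [A], and [t u] is
    interior to the cone because [u] is. *)
Lemma core_shift {u} a t :
  core (recession_cone A) u -> A a -> 0 < t -> core A (a + t *: u).
Proof.
move=> [Cu coreu] Aa t0; split; first by apply: Cu => //; exact: ltW.
move=> v; have [e e0 Ce] := coreu v.
exists (t * e); first exact: mulr_gt0.
move=> s /andP[s0 ste].
(* a perturbation [s v] of [t u] is a perturbation [(s / t) v] of [u] *)
have -> : a + t *: u + s *: v = a + t *: (u + (s / t) *: v).
  by rewrite scalerDr scalerA mulrCA divff ?gt_eqF// mulr1 addrA.
apply: Ce => //; last exact: ltW.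
by rewrite divr_ge0 ?(ltW t0)//= ler_pdivrMr// mulrC.
Qed.

Lemma entry_times_neq0 {u} y : core (recession_cone A) u -> A !=set0 ->
  exists t : R, A (y + t *: u).
Proof.
move=> coreu [a Aa]; have [t Ct] := core_cone_absorb (y - a) coreu.
by exists t; have := recession_coneD1 Ct Aa; rewrite addrA subrKC.
Qed.

(** If [b - y + t u] is a recession direction and [y + s u] is in [A], then
    [b + (t + s) u] is in [A]; for [s < - t], the recession direction [u] leads
    from there back to [b], so it is enough to choose [b] outside [A]. *)
Lemma entry_times_lbound {u} y : core (recession_cone A) u -> A <> setT ->
  exists t : R, forall s, A (y + s *: u) -> t <= s.
Proof.
move=> coreu /eqP/setTPn[b nAb].
have [t Ct] := core_cone_absorb (b - y) coreu.
exists (- t) => s As; rewrite leNgt; apply/negP => lt_s.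
apply: nAb.
have Abts : A (b + (t + s) *: u).
  have := recession_coneD1 Ct As.
  by rewrite addrACA subrKC -scalerDl addrC [s + t]addrC addrC.
have := coreu.1 _ Abts (- (t + s)).
rewrite -addrA -scalerDl subrr scale0r addr0; apply.
by rewrite oppr_ge0 addrC -lerBrDr sub0r ltW.
Qed.

End RecessionCone.

Theorem theorem2 (R : realType) (Y : lmodType R) (A : set Y) (k : Y)
  (A_nonempty : A !=set0) (A_proper : A <> setT) (k_neq0 : k <> 0)
  (k_core : opp_set (core (recession_cone A)) k) :
  (forall y : Y, exists r : R, phi A k y = Some r%:E) /\
  (forall t : R,
     [set y : Y | lt_nu (phi A k y) t] = translate (core A) (t *: k)).
Proof.
case: k_core => u coreu uk.
have rayE y t : y - t *: k = y + t *: u by rewrite -uk scalerN opprK.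
split=> [y|t].
  have [t0 At0] := entry_times_neq0 y coreu A_nonempty.
  have [m lbm] := entry_times_lbound y coreu A_proper.
  have St0 : [set t : R | translate A (t *: k) y] t0.
    by rewrite /= translateE rayE.
  rewrite /phi; case: asboolP => [S0|_]; first by rewrite S0 in St0.
  eexists; rewrite ereal_inf_EFin//; last by exists t0.
  by exists m => s /=; rewrite translateE rayE; exact: lbm.
apply/seteqP; split=> y /=; rewrite translateE rayE.
  move=> /lt_nu_phi[s st]; rewrite rayE => As.
  have -> : y + t *: u = (y + s *: u) + (t - s) *: u.
    by rewrite -addrA -scalerDl subrKC.
  by apply: core_shift; rewrite ?subr_gt0.
move=> [_ /(_ (- u)) [e e0 Ae]]; apply/lt_nu_phi.
exists (t - e); first by rewrite ltrBlDr ltrDl.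
rewrite rayE scalerBl addrA -scalerN.
by apply: Ae; rewrite lexx ltW.
Qed.
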